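(* For every natural number $d\geq 3$ there exists a nonzero harmonic polynomial on $\mathbb R^d$ that vanishes at every point of the $(d-2)$-skeleton $S_{d-2,d}$ of the unit cube $Q_d=[-1/2,1/2]^d$.
   Context: A function on $\mathbb R^d$ is harmonic if its Laplacian $\Delta=\sum_{k=1}^d \partial^2/\partial x_k^2$ applied to it is zero everywhere. Polynomials are real-valued. For $0\leq k\leq d$, the $k$-skeleton $S_{k,d}$ of the unit cube $Q_d:=[-1/2,1/2]^d$ is the union of the $k$-dimensional faces of $Q_d$; that is, (for $k<d$) the set of all points on the boundary of the cube having at least $d-k$ coordinates equal to $-1/2$ or $1/2$. *)

(* Defs.v *)
From mathcomp Require Import all_boot all_order all_algebra.
From mathcomp Require Import all_classical all_reals all_analysis.
(* The notations of mpoly clash with those of MathComp-Analysis. *)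
From mathcomp Require Import -(notations) mpoly.

Set Implicit Arguments.
Unset Strict Implicit.
Unset Printing Implicit Defensive.

Import Order.TTheory GRing.Theory Num.Theory.
Import numFieldNormedType.Exports.

Local Open Scope classical_set_scope.
Local Open Scope ring_scope.

Notation "{ 'mpoly' R [ n ] }" := (mpoly n R)
  (at level 0, R at level 2, n at level 2, format "{ 'mpoly'  R [ n ] }").

Definition polyfun (R : realType) (d : nat) (p : {mpoly R[d]})
  (x : 'rV[R]_d) : R := meval (fun i => x 0 i) p.

Definition partial (R : realType) (d : nat) (i : 'I_d) (f : 'rV[R]_d -> R)
  (x : 'rV[R]_d) : R := 'D_(delta_mx 0 i) f x.

Definition laplacian (R : realType) (d : nat) (f : 'rV[R]_d -> R)
  (x : 'rV[R]_d) : R := \sum_(k < d) partial k (partial k f) x.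

(* The directional derivative is a total operator, with an unspecified value
   where the limit does not exist; the first two clauses make the Laplacian
   meaningful. *)
Definition is_harmonic (R : realType) (d : nat) (f : 'rV[R]_d -> R) : Prop :=
  [/\ forall k x, derivable f x (delta_mx 0 k),
      forall k x, derivable (partial k f) x (delta_mx 0 k) &
      forall x, laplacian f x = 0].

Definition cube (R : realType) (d : nat) : set 'rV[R]_d :=
  [set x | forall i, - 2^-1 <= x 0 i <= 2^-1].

(* The face of dimension #|J| on which the coordinates in J are free and each
   coordinate i outside J is fixed to 1/2 or -1/2, according to the sign s i. *)
Definition cube_face (R : realType) (d : nat) (J : {set 'I_d})
  (s : 'I_d -> bool) : set 'rV[R]_d :=
  [set x | cube x /\ forall i, i \notin J -> x 0 i = (-1) ^+ s i / 2].

Definition skeleton (R : realType) (k d : nat) : set 'rV[R]_d :=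
  [set x | exists (J : {set 'I_d}) (s : 'I_d -> bool),
             #|J| = k /\ cube_face J s x].

(* For k < d the count forces x onto the boundary of the cube. *)
Lemma skeletonP (R : realType) (k d : nat) (x : 'rV[R]_d) : (k <= d)%N ->
  skeleton k x <->
  cube x /\
  (d - k <= #|[pred i : 'I_d | ((x 0 i == - 2^-1) || (x 0 i == 2^-1))%R]|)%N.
Proof.
move=> kd; set B := [pred i | _].
split=> [[J [s [cJ [cx xJ]]]]|[cx dk]].
  split=> //; have -> : (d - k = #|~: J|)%N.
    by rewrite cardsCs finset.setCK card_ord cJ.
  apply/subset_leq_card/fintype.subsetP => i; rewrite !inE => /xJ ->.
  by case: (s i); rewrite ?expr1 ?expr0 ?mulN1r ?mul1r eqxx ?orbT.
have [A AB cA] : exists2 A : {set 'I_d}, A \subset B & #|A| = (d - k)%N.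
  by have /card_geqP[t [ut st tB]] := dk; exists [set i : 'I_d in t]%SET;
    [apply/fintype.subsetP => i; rewrite inE; exact: tB
    | rewrite cardsE (card_uniqP ut)].
exists (~: A)%SET, (fun i => x 0 i == - 2^-1); split.
  by rewrite cardsCs finset.setCK card_ord cA subKn.
split=> // i; rewrite inE negbK => /(fintype.subsetP AB); rewrite inE.
by case: eqP => [-> _|_ /eqP ->]; rewrite ?expr1 ?expr0 ?mulN1r ?mul1r.
Qed.

(* Main.v *)
(* Polynomials of degree at most n harmonic in d variables form a space whose
   dimension grows like n^(d-1), while the restrictions of polynomials of degree
   at most n to the finitely many affine spans of the (d-2)-dimensional faces
   live in a space of dimension O(n^(d-2)).  For n large, some nonzero harmonic
   polynomial therefore restricts to zero on all of these spans.  Both conditions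
   are written as linear equations on the coefficients, and the equations are
   fewer than the unknowns. *)
Require Import Defs.
From mathcomp Require Import all_boot all_order all_algebra.
From mathcomp Require Import all_classical all_reals all_analysis.
From mathcomp Require Import -(notations) mpoly.

Import Order.TTheory GRing.Theory Num.Theory.
Import numFieldNormedType.Exports.

Local Open Scope classical_set_scope.
Local Open Scope ring_scope.
Set Implicit Arguments.
Unset Strict Implicit.
Unset Printing Implicit Defensive.

(** A matrix with more rows than columns has a nontrivial left kernel; rows are the unknowns [T],
    columns the equations [E]. *)
Lemma homogeneous_system_nonzero_sol (F : fieldType) (T E : finType)
    (A : T -> E -> F) : (#|E| < #|T|)%N ->
  exists2 c : T -> F, exists t, c t != 0 & forall e, \sum_t c t * A t e = 0.
Proof.
move=> ltET; pose M := \matrix_(i < #|T|, j < #|E|) A (enum_val i) (enum_val j).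
have : kermx M != 0.
  by rewrite -mxrank_eq0 mxrank_ker subn_eq0 -ltnNge (leq_ltn_trans _ ltET) ?rank_leq_col.
case/rowV0Pn => v /sub_kermxP vM /rV0Pn[j vj].
exists (fun t => v 0 (enum_rank t)); first by exists (enum_val j); rewrite enum_valK.
move=> e; have /rowP/(_ (enum_rank e)) := vM; rewrite !mxE => eq0; rewrite -[RHS]eq0.
rewrite [RHS](reindex enum_rank) /=; last exact/onW_bij/enum_rank_bij.
by apply: eq_bigr => t _; rewrite !mxE !enum_rankK.
Qed.

(** Bridge from analytic to formal derivatives, which turns harmonicity into linear equations on
    coefficients. The product rule carries the claim from variables and constants to monomials, and
    linearity to all polynomials. *)
Lemma is_derive_polyfun (R : realType) (d : nat) (p : {mpoly R[d]}) (k : 'I_d)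
    (x : 'rV[R]_d) :
  is_derive x (delta_mx 0 k) (polyfun p) (polyfun (mderiv k p) x).
Proof.
pose P (q : {mpoly R[d]}) :=
  is_derive x (delta_mx 0 k) (polyfun q) (polyfun (mderiv k q) x).
have PX i : P (mpolyX R (mnm1 i)).
  (* A coordinate function is an entry of the identity map, whose derivative in a direction is that
     direction. *)
  have [idP idE] := is_derive_id x (delta_mx 0 k).
  have -> : P (mpolyX R (mnm1 i)) =
      is_derive x (delta_mx 0 k) (fun y => y 0 i) (delta_mx (0 : 'I_1) k 0 i).
    congr is_derive; first by apply/funext => y; rewrite /polyfun mevalXU.
    rewrite mderivX mnm1E mxE eqxx /polyfun mevalZ mevalX eq_sym.
    case: eqVneq => [->|_]; last by rewrite mul0r.
    by rewrite big1 ?mulr1 // => j _; rewrite mnmBE subnn.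
  split; first by move/derivable_mxP: idP => /(_ 0 i).
  by move: (derive_mx idP); rewrite idE => /matrixP/(_ 0 i); rewrite [RHS]mxE => <-.
have PM q1 q2 : P q1 -> P q2 -> P (q1 * q2).
  rewrite /P => h1 h2.
  have -> : polyfun (q1 * q2) = polyfun q1 * polyfun q2.
    by apply/funext => y; rewrite /polyfun mevalM.
  apply: (is_derive_eq (is_deriveM h1 h2)).
  by rewrite /polyfun mderivM mevalD !mevalM addrC [X in X + _]mulrC.
have PC c : P (mpolyC d c).
  rewrite /P mderivC.
  have -> : polyfun (mpolyC d c) = cst c.
    by apply/funext => y; rewrite /polyfun mevalC.
  by rewrite /polyfun meval0; exact: is_derive_cst.
have PXn m : P (mpolyX R m).
  rewrite mpolyXE_id; elim/big_ind: _ => [|q1 q2|i _]; [exact: PC|exact: PM|].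
  by elim: (m i) => [|l IH]; [exact: PC | rewrite exprS; apply: PM].
elim/mpolyind: p => [|c m p _ _ IH]; first exact: (PC 0).
rewrite -/(P _) /P mderivD.
have -> : polyfun (c *: mpolyX R m + p) = polyfun (c *: mpolyX R m) + polyfun p.
  by apply/funext => y; rewrite /polyfun mevalD.
apply: (is_derive_eq (is_deriveD _ IH)); last by rewrite /polyfun mevalD.
by rewrite -mul_mpolyC; exact: PM.
Qed.

Definition mlap (R : realType) (d : nat) (p : {mpoly R[d]}) : {mpoly R[d]} :=
  \sum_(k < d) mderiv k (mderiv k p).

Lemma mlap_sum (R : realType) (d : nat) (I : finType) (c : I -> R)
    (q : I -> {mpoly R[d]}) :
  mlap (\sum_i c i *: q i) = \sum_i c i *: mlap (q i).
Proof.
rewrite /mlap; under [RHS]eq_bigr do rewrite scaler_sumr.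
rewrite [RHS]exchange_big; apply: eq_bigr => k _.
have mderiv_sum f : mderiv k (\sum_i c i *: f i) = \sum_i c i *: mderiv k (f i).
  by rewrite raddf_sum; apply: eq_bigr => i _; exact: mderivZ.
by rewrite !mderiv_sum.
Qed.

Lemma is_harmonic_polyfun (R : realType) (d : nat) (p : {mpoly R[d]}) :
  mlap p = 0 -> is_harmonic (polyfun p).
Proof.
move=> lap0.
have partialE q (k : 'I_d) : partial k (polyfun q) = polyfun (mderiv k q).
  by apply/funext => y; rewrite /partial; have [_] := is_derive_polyfun q k y.
split=> [k x|k x|x].
- by have [] := is_derive_polyfun p k x.
- by rewrite partialE; have [] := is_derive_polyfun (mderiv k p) k x.
transitivity (polyfun (mlap p) x); last by rewrite lap0 /polyfun meval0.
rewrite /mlap /polyfun raddf_sum; apply: eq_bigr => k _.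
by rewrite !partialE.
Qed.

(** The Laplacian lowers degrees by two, so in degree at least [b] its coefficients vanish
    automatically. Harmonicity thus costs only one equation per monomial of degree less than [b]. *)
Lemma mlap_eq0 (R : realType) (d b : nat) (p : {mpoly R[d]}) :
  (forall m, (b.+2 <= mdeg m)%N -> mcoeff m p = 0) ->
  (forall m : bmultinom d b, mcoeff m (mlap p) = 0) -> mlap p = 0.
Proof.
move=> p_lt lap0; apply/mpolyP => m; rewrite mcoeff0.
have [lt_mb|le_bm] := ltnP (mdeg m) b; first exact: (lap0 (BMultinom lt_mb)).
rewrite /mlap raddf_sum big1 // => k _.
by rewrite /= !mcoeff_mderiv p_lt ?mul0rn // !mdegD !mdeg1 !addn1 !ltnS.
Qed.

(* Multiplication by the square of the last variable embeds the monomials of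
   degree < b into those of degree < b + 2 divisible by that square; the M ^ e
   extra monomials do not involve the last variable. *)
Lemma leq_card_bmultinomSS (e M b : nat) : (e * M < b.+2)%N ->
  (#|{: bmultinom e.+1 b}| + M ^ e <= #|{: bmultinom e.+1 b.+2}|)%N.
Proof.
move=> lt_eM.
pose box (h : {ffun 'I_e -> 'I_M}) : multinom e.+1 :=
  Multinom [tuple if unlift ord_max i is Some j then val (h j) else 0 | i < e.+1]%N.
have boxE h i : box h (lift ord_max i) = h i.
  by rewrite /fun_of_multinom tnth_mktuple liftK.
have box0 h : box h ord_max = 0%N.
  by rewrite /fun_of_multinom tnth_mktuple unlift_none.
have box_lt h : (mdeg (box h) < b.+2)%N.
  apply: leq_ltn_trans lt_eM; rewrite mdegE big_ord_recr /= box0 addn0.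
  have -> : (e * M = \sum_(i < e) M)%N by rewrite sum_nat_const card_ord.
  apply: leq_sum => i _.
  rewrite (_ : widen_ord _ i = lift ord_max i) ?boxE 1?ltnW //.
  by apply: val_inj; rewrite /= /bump leqNgt ltn_ord.
pose sh (m : bmultinom e.+1 b) := mnm_add (mnm_add m (mnm1 ord_max)) (mnm1 ord_max).
have sh_lt m : (mdeg (sh m) < b.+2)%N by rewrite !mdegD !mdeg1 !addn1 !ltnS bmdeg.
pose F (u : bmultinom e.+1 b + {ffun 'I_e -> 'I_M}) : bmultinom e.+1 b.+2 :=
  match u with inl m => BMultinom (sh_lt m) | inr h => BMultinom (box_lt h) end.
have : injective F.
  have neq m h : sh m <> box h.
    by move=> /mnmP/(_ ord_max); rewrite box0 !mnmDE mnm1E eqxx !addn1.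
  move=> [m|h] [m'|h'] /(congr1 (@bmnm _ _)) /=.
  - move/mnmP => mm'; congr inl; apply/val_inj/mnmP => i.
    by have := mm' i; rewrite !mnmDE => /addIn/addIn.
  - by move/neq.
  - by move/esym/neq.
  - by move/mnmP => hh; congr inr; apply/ffunP => i; apply: val_inj; rewrite /= -!boxE.
by move/leq_card; rewrite card_sum card_ffun !card_ord.
Qed.

(** The exponent that survives when the variables outside [J] become constants. Entries of [m] are
    at most [b], so [inord] does not alter them. *)
Definition restr (d b : nat) (J : {set 'I_d}) (m : bmultinom d b.+1) :
    {ffun 'I_d -> 'I_b.+1} :=
  [ffun i => if i \in J then inord (m i) else ord0].

Lemma restr_pffun_on (d b : nat) (J : {set 'I_d}) (m : bmultinom d b.+1) :
  restr J m \in pffun_on ord0 J predT.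
Proof.
apply/pffun_onP; split=> //.
by apply/fintype.subsetP => i; rewrite inE ffunE; case: ifP => //; rewrite eqxx.
Qed.

Lemma polyfun_flat_eq0 (R : realType) (d b : nat) (c : bmultinom d b.+1 -> R)
    (J : {set 'I_d}) (v : 'I_d -> R) (x : 'rV[R]_d) :
  (* the left-hand side is the coefficient of x ^ g in the restriction *)
  (forall g, g \in pffun_on ord0 J predT ->
    \sum_m c m * (if restr J m == g then \prod_(i | i \notin J) v i ^+ m i else 0)
      = 0) ->
  (forall i, i \notin J -> x 0 i = v i) ->
  polyfun (\sum_m c m *: mpolyX R m) x = 0.
Proof.
move=> c0 xv; rewrite /polyfun raddf_sum /=.
(* Monomials with the same restriction [g] share the factor x ^ g in the free variables; what
   remains of each group is the coefficient assumed to be zero. *)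
rewrite (partition_big (restr J) (mem (pffun_on ord0 J predT))) /=; last first.
  by move=> m _; exact: restr_pffun_on.
apply: big1 => g gJ.
transitivity (\prod_(i in J) x 0 i ^+ g i * 0); last by rewrite mulr0.
rewrite -[in RHS](c0 g gJ) mulr_sumr big_mkcond; apply: eq_bigr => m _.
case: eqP => [<-|_]; last by rewrite !mulr0.
rewrite mevalZ mevalX (bigID (mem J)) /= mulrCA; congr (_ * (_ * _)).
  apply: eq_bigr => i iJ; rewrite ffunE iJ inordK //.
  by rewrite (leq_ltn_trans _ (bmdeg m)) // mdegE (bigD1 i) //= leq_addr.
by apply: eq_bigr => i iJ; rewrite xv.
Qed.

Theorem theorem1 (R : realType) (d : nat) (hd : (3 <= d)%N) :
  exists p : {mpoly R[d]},
    [/\ p != 0, is_harmonic (polyfun p) &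
        forall x : 'rV[R]_d, skeleton (d - 2) x -> polyfun p x = 0].
Proof.
case: d hd => // -[] // -[] // e _; set d := e.+3.
(* With [b.+2 = d * M], the faces give at most [2 ^ d * 2 ^ d * (d * M) ^ e.+1] equations, where
   [e.+1] is [d - 2]. This [M] is just large enough for the [M ^ e.+2] surplus monomials to
   outnumber them. *)
pose M := (2 ^ d * 2 ^ d * d ^ e.+1).+1.
pose b := (d * M).-2.
have bE : b.+2 = (d * M)%N by rewrite /b /d; case: (M) (isT : 0 < M)%N => // -[].
pose isflat (z : {set 'I_d} * {ffun 'I_d -> bool} * {ffun 'I_d -> 'I_b.+2}) :=
  (#|z.1.1| == e.+1) && (z.2 \in pffun_on ord0 z.1.1 predT).
(* Column [inl m'] is the coefficient of the Laplacian at [m']; column [inr z] is the coefficient at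
   [g] of the restriction to the flat given by [J] and the signs [s]. *)
pose A (m : bmultinom d b.+2) (t : bmultinom d b + {z | isflat z}) : R :=
  match t with
  | inl m' => mcoeff m' (mlap (mpolyX R m))
  | inr z => let: (J, s, g) := val z in
    if restr J m == g then \prod_(i | i \notin J) ((-1) ^+ s i / 2) ^+ m i else 0
  end.
have card_flat : (#|isflat| <= 2 ^ d * 2 ^ d * b.+2 ^ e.+1)%N.
  have -> : #|isflat| = (\sum_(w : {set 'I_d} * {ffun 'I_d -> bool})
      \sum_(g | isflat (w, g)) 1)%N.
    by rewrite pair_big_dep /= -sum1_card; apply: eq_bigl => -[].
  have -> : (2 ^ d * 2 ^ d =
      #|{: {set 'I_d} * {ffun 'I_d -> bool}}|)%N.
    by rewrite card_prod card_ffun card_bool card_ord -cardsT -powersetT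
      card_powerset cardsT card_ord.
  rewrite -sum_nat_const; apply: leq_sum => -[J s] _.
  have [cJ|cJ] := eqVneq #|J| e.+1; last first.
    by rewrite big_pred0 // => g; rewrite /isflat (negbTE cJ).
  have -> : (b.+2 ^ e.+1 = #|pffun_on (@ord0 b.+1) (mem J) predT|)%N.
    by rewrite card_pffun_on cJ card_ord.
  rewrite -[leqRHS]sum1_card; apply: eq_leq; apply: eq_bigl => g.
  by rewrite /isflat cJ eqxx.
have ltET : (#|{: bmultinom d b + {z | isflat z}}| < #|{: bmultinom d b.+2}|)%N.
  rewrite card_sum card_sig.
  apply: leq_trans (@leq_card_bmultinomSS e.+2 M b _); last first.
    by rewrite bE ltn_pmul2r.
  rewrite ltn_add2l; apply: leq_ltn_trans card_flat _.
  (* Cancelling [M ^ e.+1] leaves [2 ^ d * 2 ^ d * d ^ e.+1 < M]. *)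
  by rewrite bE expnMn mulnA [(M ^ e.+2)%N]expnS ltn_pmul2r ?expn_gt0.
have [c [m0 cm0] cA] := homogeneous_system_nonzero_sol A ltET.
pose p := \sum_m c m *: mpolyX R m.
have pE (m : bmultinom d b.+2) : mcoeff m p = c m.
  rewrite raddf_sum (bigD1 m) //= mcoeffZ mcoeffX eqxx mulr1 big1 ?addr0 // => m' m'm.
  by rewrite mcoeffZ mcoeffX -bmeqP (negbTE m'm) mulr0.
exists p; split.
- by apply: contraNneq cm0 => p0; rewrite -pE p0 mcoeff0.
- apply: is_harmonic_polyfun; apply: (@mlap_eq0 _ _ b) => [m le_bm|m].
    rewrite raddf_sum big1 // => m' _; rewrite /= mcoeffZ mcoeffX.
    case: eqP => [m'm|]; last by rewrite mulr0.
    by have := bmdeg m'; rewrite m'm ltnNge le_bm.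
  rewrite -(cA (inl m)) mlap_sum raddf_sum.
  by apply: eq_bigr => m' _; exact: mcoeffZ.
- move=> x [J [s [cJ [_ xJ]]]].
  apply: (@polyfun_flat_eq0 _ _ _ _ J (fun i => (-1) ^+ s i / 2)) => // g gJ.
  (* The signs become a finite function because the equations are indexed by a finite type. *)
  have zP : isflat (J, [ffun i => s i], g) by rewrite /isflat cJ subSS subn1 eqxx.
  rewrite -[RHS](cA (inr (exist (fun z => isflat z) _ zP))) /=; apply: eq_bigr => m _; congr (_ * _).
  by case: eqP => // _; apply: eq_bigr => i _; rewrite ffunE.
Qed.
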